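(* Let $d\ge 2$ and let $\eta$ be an $\mathbb{N}$-valued random variable with $\mathbf{P}[\eta\ge 1]>0$. Suppose that $\mathbf{E}\big[(\log(\eta\vee 1))^d\big]<\infty$. Then $p_c(\mathbb{Z}^d,\eta)>0$.
   Context: Here $a\vee b=\max\{a,b\}$, $\mathbb{N}=\{0,1,2,\dots\}$, and $\mathbb{Z}^d$ denotes the graph with vertex set $\mathbb{Z}^d$ and edges between points at $\ell^1$-distance $1$, with root $\mathbf{0}$ the origin. Frog model $\mathrm{FM}(\mathcal{G},p,\eta)$. Let $\mathcal{G}$ be an infinite connected undirected graph all of whose sites (vertices) have finite degree, with a fixed site $\mathbf{0}$ called the root; let $p\in[0,1]$ and let $\eta$ be a random variable with values in $\mathbb{N}$. Let $\{\eta(x)\}_{x}$, $\{(S^x_n(i))_{n\in\mathbb{N}}\}_{x,\,i\ge1}$, $\{\Xi^x_p(i)\}_{x,\,i\ge 1}$ be independent families of independent random variables, where $\eta(x)$ has the law of $\eta$, $(S^x_n(i))_n$ is a discrete-time simple random walk on $\mathcal{G}$ started from $x$, and $\mathbf{P}[\Xi^x_p(i)=k]=(1-p)p^{k-1}$, $k=1,2,\dots$ (for $p=1$, $\Xi^x_p(i)=\infty$, no death). Site $x$ initially contains $\eta(x)$ particles; at time $0$ all particles are sleeping except those at the root, which are active. If the particles of site $x$ are activated at time $T(x)$, the $i$-th of them ($1\le i\le\eta(x)$) is active and located at $S^x_n(i)$ at time $T(x)+n$ for $0\le n<\Xi^x_p(i)$, and then disappears. When an active particle visits a site, all sleeping particles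 there become active. Formally, $t(x,y)=\min_{1\le i\le\eta(x)}\min\{n<\Xi^x_p(i):S^x_n(i)=y\}$ for $x\ne y$ ($\infty$ if there is no such $n$), and $T(x)=\inf\{t(x_0,x_1)+\dots+t(x_{m-1},x_m)\}$ over all finite sequences $\mathbf{0}=x_0,x_1,\dots,x_m=x$, with $T(\mathbf{0})=0$; $T(x)=\infty$ means that $x$ is never visited by active particles. The model survives if at every time there is at least one active particle; otherwise it dies out. The critical parameter is $p_c(\mathcal{G},\eta)=\inf\{p\in[0,1]:\mathbf{P}[\mathrm{FM}(\mathcal{G},p,\eta)\text{ survives}]>0\}$. *)

(* Defs.v *)
From HB Require Import structures.
From mathcomp Require Import all_boot all_order all_algebra.
From mathcomp Require Import finmap zify.
From mathcomp Require Import all_classical all_reals all_analysis.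
Set Implicit Arguments.
Unset Strict Implicit.
Unset Printing Implicit Defensive.
Import Order.TTheory GRing.Theory Num.Theory.
Local Open Scope classical_set_scope.
Local Open Scope ring_scope.

Record rooted_graph := RootedGraph {
  vertex :> countType;
  adj : rel vertex;
  root : vertex;
  adj_sym : symmetric adj;
  adj_irr : irreflexive adj;
  adj_fin : forall x, finite_set [set y | adj x y] }.

Definition degree (G : rooted_graph) (x : G) : nat :=
  #|` fset_set [set y | adj x y] |%fset.

Section Lattice.
Variable d : nat.

Definition lattice_adj (x y : 'rV[int]_d) : bool :=
  \sum_(i < d) `|x ord0 i - y ord0 i| == 1.

Lemma lattice_adj_sym : symmetric lattice_adj.
Proof.
move=> x y; rewrite /lattice_adj.
by congr (_ == _); apply: eq_bigr => i _; rewrite distrC.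
Qed.

Lemma lattice_adj_irr : irreflexive lattice_adj.
Proof.
move=> x; rewrite /lattice_adj big1 // => i _.
by rewrite subrr normr0.
Qed.

Lemma lattice_adj_fin x : finite_set [set y | lattice_adj x y].
Proof.
pose f (s : {ffun 'I_d -> 'I_3}) : 'rV[int]_d :=
  \row_i (x ord0 i + (s i : nat)%:Z - 1).
apply: (@sub_finite_set _ _ (f @` setT)); last exact/finite_image/finite_finset.
move=> y /= /eqP xy1.
have near i : `|x ord0 i - y ord0 i| <= 1.
  by rewrite -xy1 (bigD1 i) //= lerDl sumr_ge0.
exists [ffun i => inord (absz (y ord0 i - x ord0 i + 1))] => //.
apply/rowP => i; rewrite mxE ffunE.
have := near i; move: (x ord0 i) (y ord0 i) => a b; rewrite ler_norml => /andP[lo hi].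
rewrite inordK; last by lia.
by rewrite gez0_abs; lia.
Qed.

Definition lattice : rooted_graph :=
  @RootedGraph 'rV[int]_d lattice_adj 0
    lattice_adj_sym lattice_adj_irr lattice_adj_fin.

End Lattice.

Section Independence.
Local Open Scope ereal_scope.
Context {R : realType} {d : measure_display} {Omega : measurableType d}.
Variable P : probability Omega R.

(* The sigma-algebra generated by a family of maps into T, where T carries the
   discrete sigma-algebra; only used for countable T. *)
Definition sigma_of (I T : Type) (X : I -> Omega -> T) : set (set Omega) :=
  <<s [set A | exists i (B : set T), A = X i @^-1` B] >>.

Definition mutually_independent (J : eqType) (F : J -> set (set Omega)) : Prop :=
  forall (s : seq J) (A : J -> set Omega), uniq s ->
    (forall j, j \in s -> F j (A j)) ->
    P (\bigcap_(j in [set` s]) A j) = \prod_(j <- s) P (A j).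

End Independence.

Section FrogModel.
Local Open Scope ereal_scope.
Context {R : realType}.
Variable G : rooted_graph.

Definition srw_step (x y : G) : R :=
  (if adj x y then (degree x)%:R^-1 else 0)%R.

(* The Markov property is stated with the conditioning multiplied out. *)
Definition simple_random_walk (d : measure_display) (Omega : measurableType d)
    (P : probability Omega R) (x : G) (S : nat -> Omega -> G) : Prop :=
  [/\ forall n (B : set G), measurable (S n @^-1` B),
      P [set w | S 0%N w = x] = 1 &
      forall n (s : nat -> G),
        P [set w | forall k, (k <= n.+1)%N -> S k w = s k] =
        P [set w | forall k, (k <= n)%N -> S k w = s k]
          * (srw_step (s n) (s n.+1))%:E].

(* A lifetime is an option nat, with None standing for an infinite one. *)
Definition geometric_lifetime (d : measure_display) (Omega : measurableType d)
    (P : probability Omega R) (p : R) (Xi : Omega -> option nat) : Prop :=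
  [/\ forall B : set (option nat), measurable (Xi @^-1` B),
      forall k, (1 <= k)%N ->
        P [set w | Xi w = Some k] = ((1 - p) * p ^+ k.-1)%:E &
      p = 1%R -> P [set w | Xi w = None] = 1].

Definition alive_at (n : nat) (l : option nat) : Prop :=
  if l is Some k then (n < k)%N else True.

(* Particles of a site are numbered from 0: those present at x are the i with
   i < frogs x w. *)
Record frog_model (mu : probability nat R) (p : R) (d : measure_display)
    (Omega : measurableType d) (P : probability Omega R) := FrogModel {
  frogs : G -> {RV P >-> nat};
  walk : G -> nat -> nat -> Omega -> G;
  lifetime : G -> nat -> Omega -> option nat;
  frogs_law : forall x (A : set nat), distribution P (frogs x) A = mu A;
  walk_law : forall x i, simple_random_walk P x (walk x i);
  lifetime_law : forall x i, geometric_lifetime P p (lifetime x i);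
  frog_independence :
    mutually_independent P (fun j : G + (G * nat) + (G * nat) =>
      match j with
      | inl (inl x) => sigma_of (fun _ : unit => frogs x : Omega -> nat)
      | inl (inr (x, i)) => sigma_of (walk x i)
      | inr (x, i) => sigma_of (fun _ : unit => lifetime x i)
      end) }.

Section Dynamics.
Variables (mu : probability nat R) (p : R) (d : measure_display).
Variables (Omega : measurableType d) (P : probability Omega R).
Variable M : frog_model mu p P.

Definition hitting_time (w : Omega) (x y : G) : \bar R :=
  ereal_inf [set n%:R%:E | n in [set n : nat | exists i : nat,
    [/\ (i < frogs M x w)%N, alive_at n (lifetime M x i w)
      & walk M x i n w = y]]].

Definition activation_time (w : Omega) (x : G) : \bar R :=
  ereal_inf [set \sum_(t <- pairmap (hitting_time w) (root G) s) t |
    s in [set s : seq G |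
      path [rel y z | y != z] (root G) s /\ last (root G) s = x]].

Definition active_at (w : Omega) (m : nat) (x : G) (i : nat) : Prop :=
  (i < frogs M x w)%N /\
  exists2 n, alive_at n (lifetime M x i w) &
    activation_time w x + n%:R%:E = m%:R%:E.

Definition survives : set Omega :=
  [set w | forall m : nat, exists x i, active_at w m x i].

End Dynamics.

(* The law of a frog model is determined by G, mu and p, so the choice of the
   probability space carrying it is immaterial. *)
Definition survives_with_positive_probability
    (mu : probability nat R) (p : R) : Prop :=
  exists (d : measure_display) (Omega : measurableType d)
    (P : probability Omega R) (M : frog_model mu p P), 0 < P (survives M).

Definition critical_parameter (mu : probability nat R) : \bar R :=
  ereal_inf [set p%:E | p in [set p : R |
    (0 <= p <= 1)%R /\ survives_with_positive_probability mu p]].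

End FrogModel.

(* Main.v *)
Require Import Defs.
From mathcomp Require Import all_boot all_order all_algebra.
From mathcomp Require Import zify lra.
From mathcomp Require Import all_classical all_reals all_analysis.
From mathcomp Require Import measurable_realfun.
Import Order.TTheory GRing.Theory Num.Theory.
Import numFieldNormedType.Exports.
Local Open Scope classical_set_scope.
Local Open Scope ring_scope.
Set Implicit Arguments.
Unset Strict Implicit.
Unset Printing Implicit Defensive.

(** A particle of [x] can reach [y] only if it is still alive after
    [r = |y - x|] steps, for the sup norm.  For a base [b], this forces
    [eta x >= b ^ r], or one of the first [b ^ r] particles of [x] to live that
    long, so it has probability at most [P (eta >= b ^ r) + (b p) ^ r].
    Summed over [y <> x], the first terms count the lattice points in the box of
    radius [log eta / log b], which costs at most a constant times
    [E (log (eta \/ 1)) ^ d / (log b) ^ d]; hence the whole sum is at most 1/2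
    for [b] large and then [p] small.  Since distinct sites are independent, the
    probability that a self-avoiding chain of [n] such steps starts at the root
    is at most [2 ^ - n], so almost surely finitely many sites are visited, each
    by finitely many particles with finite lifetimes.  As [P] is unconstrained
    on non-measurable sets, survival must also be shown to be measurable. *)

(** * Unions and infima indexed by countable types *)

Section CountableFamilies.
Local Open Scope ereal_scope.
Context {R : realType} {dO : measure_display} {Omega : measurableType dO}.
Variable P : probability Omega R.

Lemma bigcup_countType_measurable (T : countType) (C : T -> set Omega) :
  (forall y, measurable (C y)) -> measurable (\bigcup_y C y).
Proof. by move=> mC; apply: countable_bigcupT_measurable. Qed.

(** Sigma-subadditivity, transported along [pickle]: each partial sum of the series is a sum over a
    duplicate-free list, so bounds on finite sums suffice and no series over [T] is needed. *)
Lemma le_measure_bigcup_countType (T : countType) (C : T -> set Omega)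
    (A : set Omega) (c : \bar R) :
  measurable A -> (forall y, measurable (C y)) -> A `<=` \bigcup_y C y ->
  (forall s : seq T, uniq s -> \sum_(y <- s) P (C y) <= c) -> P A <= c.
Proof.
move=> mA mC AC sc.
pose F (k : nat) := if @pickle_inv T k is Some y then C y else set0.
have mF k : measurable (F k) by rewrite /F; case: (@pickle_inv T _).
have AF : A `<=` \bigcup_k F k.
  move=> w /AC [y _ Cy]; exists (pickle y) => //.
  by rewrite /F pickleK_inv.
apply: (le_trans (measure_sigma_subadditive P mF mA AF)).
apply: lime_le; first exact: is_cvg_nneseries.
apply: nearW => n.
rewrite (_ : \sum_(0 <= k < n) P (F k) =
    \sum_(y <- pmap (@pickle_inv T) (index_iota 0 n)) P (C y)).
  by apply: sc; rewrite (pmap_uniq (g := pickle)) ?iota_uniq//; exact: (@pickle_invK T).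
elim: (index_iota 0 n) => [|k s IH]; first by rewrite !big_nil.
rewrite big_cons IH /F /=; case: (@pickle_inv T _) => [y|] /=; first by rewrite big_cons.
by rewrite measure0 add0e.
Qed.

(** Handles a random index set: an index outside it is given the value [+oo], which leaves the
    infimum unchanged. Hitting and activation times have this form. *)
Lemma measurable_ereal_inf_countType (T : countType)
    (D : T -> set Omega) (f : T -> Omega -> \bar R) :
  (forall y, measurable (D y)) -> (forall y, measurable_fun setT (f y)) ->
  measurable_fun setT
    (fun w => ereal_inf [set f y w | y in [set y | D y w]]).
Proof.
move=> mD mf.
pose g (k : nat) w := if @pickle_inv T k is Some y then
  if w \in D y then f y w else +oo else +oo.
have mg k : measurable_fun setT (g k).
  rewrite /g; case: (@pickle_inv T _) => [y|] //.
  apply: measurable_fun_ifT => //.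
  apply: (measurable_fun_bool true); rewrite setTI.
  rewrite (_ : _ @^-1` _ = D y) //.
  by apply/seteqP; split => w /=; [exact: set_mem|exact: mem_set].
suff -> : (fun w => ereal_inf [set f y w | y in [set y | D y w]]) =
    (fun w => einfs (g ^~ w) 0%N) by exact: measurable_fun_einfs.
apply/funext => w; apply/eqP; rewrite eq_le; apply/andP; split.
  apply/ereal_infP => _ [k _ <-]; rewrite /g.
  case: (@pickle_inv T _) => [y|]; last exact: leey.
  case: ifPn => [|_]; last exact: leey.
  by move=> /set_mem Dy; apply: ge_ereal_inf; exists (f y w) => //; exists y.
apply/ereal_infP => _ [y Dy <-].
apply: ge_ereal_inf; exists (f y w) => //; exists (pickle y) => //.
by rewrite /g pickleK_inv mem_set.
Qed.

End CountableFamilies.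

(** * Independent events and geometric tails *)

Section Independence.
Local Open Scope ereal_scope.
Context {R : realType} {dO : measure_display} {Omega : measurableType dO}.
Variable P : probability Omega R.

Lemma negligible_bigcup_countType (T : countType) (C : T -> set Omega) :
  (forall y, P.-negligible (C y)) -> P.-negligible (\bigcup_y C y).
Proof.
move=> nC.
pose F (k : nat) := if @pickle_inv T k is Some y then C y else set0.
apply: (@negligibleS _ _ _ P (\bigcup_k F k)).
  by move=> w [y _ Cy]; exists (pickle y) => //; rewrite /F pickleK_inv.
apply: negligible_bigcup => k; rewrite /F; case: (@pickle_inv T _) => [y|].
  exact: nC.
exact: negligible_set0.
Qed.

(** Merging everything into one intersection over [j :: s] gives the form needed both by
    [mutually_independent] and by the induction in [chain_bound]. *)
Lemma setI_bigcap_seq (J : eqType) (T : Type) (s : seq J) (A : J -> set T)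
    (j : J) (C : set T) : j \notin s ->
  C `&` \bigcap_(i in [set` s]) A i =
    \bigcap_(i in [set` j :: s]) (if i == j then C else A i).
Proof.
move=> js; have ns i : i \in s -> (i == j) = false.
  by case: eqP => // ->; rewrite (negbTE js).
apply/seteqP; split => [w [Cw Aw] i|w Aw].
  by rewrite /= inE; case: eqP => //= _; exact: Aw.
split; first by have := Aw j; rewrite eqxx; apply; rewrite /= inE eqxx.
by move=> i /= iS; have := Aw i; rewrite ns //; apply; rewrite /= inE iS orbT.
Qed.

Lemma mutually_independent_setI (J : eqType) (F : J -> set (set Omega))
    (s : seq J) (A : J -> set Omega) (j : J) (C : set Omega) :
  mutually_independent P F -> uniq s -> (forall i, i \in s -> F i (A i)) ->
  j \notin s -> F j C ->
  P (C `&` \bigcap_(i in [set` s]) A i) =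
    P C * P (\bigcap_(i in [set` s]) A i).
Proof.
move=> indF us FA js FC.
rewrite (setI_bigcap_seq _ _ js); pose A' i := if i == j then C else A i.
have A'E i : i \in s -> A' i = A i.
  by rewrite /A'; case: eqP => // ->; rewrite (negbTE js).
rewrite (indF (j :: s) A') /=; last 2 first.
- by rewrite js us.
- move=> i; rewrite inE => /orP[/eqP ->|iS]; first by rewrite /A' eqxx.
  by rewrite A'E //; apply: FA.
rewrite big_cons {1}/A' eqxx (indF s A) //.
by congr (_ * _); apply: eq_big_seq => i iS; rewrite A'E.
Qed.

Lemma sigma_of_measurable (I T : Type) (X : I -> Omega -> T) (A : set Omega) :
  (forall i (B : set T), measurable (X i @^-1` B)) ->
  sigma_of X A -> measurable A.
Proof.
move=> mX; apply: smallest_sub; first exact: sigma_algebra_measurable.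
by move=> _ [i [B ->]]; apply: mX.
Qed.

Lemma sigma_of_preimage (I T : Type) (X : I -> Omega -> T) i (B : set T) :
  sigma_of X (X i @^-1` B).
Proof. by apply: sub_sigma_algebra; exists i, B. Qed.

(** From [r] to [r.+1] the tail loses exactly the mass [(1 - p) * p ^+ r] of the lifetime [r.+1],
    and [p ^+ r - (1 - p) * p ^+ r = p ^+ r.+1]. *)
Lemma geometric_lifetime_tail (p : R) (Xi : Omega -> option nat) (r : nat) :
  geometric_lifetime P p Xi ->
  P [set w | alive_at r (Xi w)] <= (p ^+ r)%:E.
Proof.
move=> [mXi PXi _]; elim: r => [|r IH].
  by apply: probability_le1; apply: (mXi (alive_at 0)).
have : P [set w | alive_at r (Xi w)] =
    P [set w | alive_at r.+1 (Xi w)] + ((1 - p) * p ^+ r)%:E.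
  rewrite -(PXi r.+1) //= -measureU //=.
  - congr (P _); apply/seteqP; split => w /=; case: (Xi w) => [k|] /=.
    + by rewrite leq_eqVlt => /orP[/eqP ->|]; [right|left].
    + by left.
    + by move=> [/ltnW //|[->]].
    + by [].
  - exact: (mXi (alive_at r.+1)).
  - exact: (mXi [set Some r.+1]).
  - apply/seteqP; split => // w /= [+ e]; rewrite e /=.
    by rewrite ltnn.
move=> e; move: IH; rewrite {}e -leeBrDr //.
by rewrite -EFinB exprS mulrBl mul1r opprB addrC subrK.
Qed.

End Independence.

(** * Speed of the simple random walk *)

Section WalkSpeed.
Local Open Scope ereal_scope.
Context {R : realType} {dO : measure_display} {Omega : measurableType dO}.
Variables (P : probability Omega R) (G : rooted_graph) (delta : G -> G -> nat).
Hypothesis delta_refl : forall x, delta x x = 0%N.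
Hypothesis delta_step :
  forall x y z, adj y z -> (delta x z <= (delta x y).+1)%N.

(** A finite trajectory of positive probability starts at [x] and follows edges, so [delta x] grows
    by at most one per step along it; there are countably many finite trajectories. *)
Lemma simple_random_walk_speed (x : G) (S : nat -> Omega -> G) :
  simple_random_walk P x S ->
  P.-negligible [set w | exists n, (n < delta x (S n w))%N].
Proof.
move=> [mS S0 SM].
pose C n (s : nat -> G) := [set w | forall k, (k <= n)%N -> S k w = s k].
have mC n s : measurable (C n s).
  rewrite (_ : C n s = \bigcap_(k in [set k | (k <= n)%N]) S k @^-1` [set s k]) //.
  by apply: bigcap_measurableType => k _; apply: mS.
have C0 n : forall s, P (C n s) != 0 -> (delta x (s n) <= n)%N.
  elim: n => [|n IH] s.
    have [->|sx] := eqVneq (s 0%N) x; first by rewrite delta_refl.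
    move=> /negP[]; rewrite -measure_le0.
    rewrite (@le_trans _ _ (P (~` [set w | S 0%N w = x]))) //.
      apply: le_measure; rewrite ?inE //.
        by apply: measurableC; apply: (mS 0%N [set x]).
      by move=> w Cw /= e; move: sx; rewrite -(Cw 0%N) // e eqxx.
    rewrite probability_setC; last exact: (mS 0%N [set x]).
    by rewrite [X in 1 - X]S0 subee.
  rewrite [P _]SM mule_eq0 negb_or => /andP[/IH sn].
  rewrite /srw_step; case: ifPn => [a _|_]; last by rewrite eqxx.
  exact: (leq_trans (delta_step x a)).
(* Trajectories up to time [n] are coded by finite sequences, which keeps the union countable. *)
apply: (@negligibleS _ _ _ P (\bigcup_n \bigcup_(s : seq G)
   if (n < delta x (nth x s n))%N then C n (nth x s) else set0)).
  move=> w [n nw]; exists n => //; exists (mkseq (S ^~ w) n.+1) => //.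
  rewrite nth_mkseq // nw => k kn; by rewrite nth_mkseq.
apply: negligible_bigcup => n; apply: negligible_bigcup_countType => s.
case: ifPn => [ns|_]; last exact: negligible_set0.
apply/negligibleP => //; apply/eqP; apply: contraTT ns => /C0.
by rewrite -leqNgt.
Qed.

End WalkSpeed.

(** * Probability of long self-avoiding chains *)

Section ExitChains.
Local Open Scope ereal_scope.
Context {R : realType} {G : rooted_graph} {mu : probability nat R} {p : R}.
Context {dO : measure_display} {Omega : measurableType dO}.
Context {P : probability Omega R}.
Variables (M : frog_model G mu p P) (delta : G -> G -> nat).

Definition particle_index : Type := (G + (G * nat) + (G * nat))%type.

(** This is the family appearing in [frog_independence], named so that it can be passed to the
    independence lemmas. *)
Definition particle_sigma (j : particle_index) : set (set Omega) :=
  match j with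
  | inl (inl x) => sigma_of (fun _ : unit => frogs M x : Omega -> nat)
  | inl (inr (x, i)) => sigma_of (walk M x i)
  | inr (x, i) => sigma_of (fun _ : unit => lifetime M x i)
  end.

Definition particle_site (j : particle_index) : G :=
  match j with inl (inl x) => x | inl (inr (x, _)) => x | inr (x, _) => x end.

Lemma measurable_frogs x (B : set nat) : measurable (frogs M x @^-1` B).
Proof. exact: measurable_funPTI. Qed.

Lemma measurable_lifetime x i (B : set (option nat)) :
  measurable (lifetime M x i @^-1` B).
Proof. by have [] := lifetime_law M x i. Qed.

Lemma measurable_walk x i n (B : set G) : measurable (walk M x i n @^-1` B).
Proof. by have [] := walk_law M x i. Qed.

Lemma particle_sigma_measurable j (A : set Omega) :
  particle_sigma j A -> measurable A.
Proof.
move: j => [[x|[x i]]|[x i]]; apply: sigma_of_measurable.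
- by move=> _; exact: measurable_frogs.
- exact: measurable_walk.
- by move=> _; exact: measurable_lifetime.
Qed.

(* The walks do not enter the definition: almost surely, a particle of [x] needs
   at least [delta x y] steps to reach [y]. *)
Definition may_reach (x y : G) : set Omega :=
  [set w | exists i, (i < frogs M x w)%N /\
    alive_at (delta x y) (lifetime M x i w)].

Lemma measurable_may_reach x y : measurable (may_reach x y).
Proof.
rewrite (_ : may_reach x y = \bigcup_i ((frogs M x @^-1` [set k | (i < k)%N]) `&`
    (lifetime M x i @^-1` alive_at (delta x y)))).
  apply: bigcup_measurable => i _; apply: measurableI.
    exact: measurable_frogs.
  exact: measurable_lifetime.
by apply/seteqP; split => w [i]; [move=> ?; exists i|move=> _ ?; exists i].
Qed.

(* [a] lists the sites to which the chain may not return. *)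
Fixpoint chain (n : nat) (x : G) (a : seq G) : set Omega :=
  if n is k.+1 then
    \bigcup_y (if y \in x :: a then set0 else may_reach x y `&` chain k y (x :: a))
  else setT.

Lemma measurable_chain n x a : measurable (chain n x a).
Proof.
elim: n x a => [|n IH] x a /=; first exact: measurableT.
apply: bigcup_countType_measurable => y; case: ifP => // _.
by apply: measurableI; [exact: measurable_may_reach|exact: IH].
Qed.

(** In the induction [a] absorbs the sites already left, so the rest of the path must avoid [a]; for
    a duplicate-free path this condition is preserved. *)
Lemma path_chain w s x a :
  path (fun y z => `[< may_reach y z w >]) x s -> uniq (x :: s) ->
  all (fun z => z \notin a) s -> chain (size s) x a w.
Proof.
elim: s x a => [//|y s IH] x a /= /andP[/asboolP xy ys] /andP[xs /andP[ysn us]].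
move=> /andP[ya sa]; exists y => //.
rewrite inE (negbTE ya) orbF; case: eqP => [e|_].
  by move: xs; rewrite e inE eqxx.
split=> //; apply: IH => //=; first by rewrite ysn.
apply/allP => z zs; rewrite inE negb_or (allP sa) // andbT.
by apply: contraNneq xs => <-; rewrite inE zs orbT.
Qed.

Variable K : nat -> nat.

(** A union bound with cutoff [K r] on the number of particles: either the cutoff is attained, or
    one of the first [K r] particles lives at least [r] steps. *)
Definition reach_bound (r : nat) : \bar R :=
  mu [set k | (K r <= k)%N] + ((K r)%:R * p ^+ r)%:E.

Hypothesis p_ge0 : (0 <= p)%R.

Lemma reach_bound_ge0 r : 0 <= reach_bound r.
Proof. by apply: adde_ge0; rewrite ?lee_fin ?mulr_ge0 ?exprn_ge0.
Qed.

Variable m : R.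
Hypothesis m_ge0 : (0 <= m)%R.
Hypothesis reach_bound_sum : forall x (s : seq G), uniq s -> x \notin s ->
  \sum_(y <- s) reach_bound (delta x y) <= m%:E.

(* Opening the particles of a new site costs at most [reach_bound], and what
   has been opened before stays independent of the rest of the chain. *)
Lemma chain_bound n x a (t : seq particle_index)
    (A : particle_index -> set Omega) :
  x \notin a -> uniq t -> (forall j, j \in t -> particle_sigma j (A j)) ->
  (forall j, j \in t -> particle_site j \in a) ->
  P (\bigcap_(j in [set` t]) A j `&` chain n x a) <=
    (m ^+ n)%:E * P (\bigcap_(j in [set` t]) A j).
Proof.
elim: n x a t A => [|n IH] x a t A xa ut tA ta.
  by rewrite /= setIT expr0 mul1e.
have mB : measurable (\bigcap_(j in [set` t]) A j).
  apply: fin_bigcap_measurable; first exact: finite_seq.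
  by move=> j /= jt; apply: particle_sigma_measurable (tA _ jt).
(* The index [j] is new because its site [x] is not in [a]. The induction hypothesis, applied with
   [U] added to the opened events, removes the chain from [y]; independence then splits off
   [P U]. *)
have open1 j (U : set Omega) y : y \notin x :: a ->
    particle_site j = x -> particle_sigma j U ->
    P (U `&` \bigcap_(i in [set` t]) A i `&` chain n y (x :: a)) <=
    (m ^+ n)%:E * P (\bigcap_(i in [set` t]) A i) * P U.
  move=> yxa jx jU.
  have jt : j \notin t by apply: contra xa => /ta; rewrite jx.
  have PUB := mutually_independent_setI (F := particle_sigma)
    (@frog_independence _ _ _ _ _ _ _ M) ut tA jt jU.
  rewrite -muleA [X in _ <= _ * X]muleC -PUB.
  rewrite (setI_bigcap_seq _ _ jt); apply: IH => //=.
  - by rewrite jt.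
  - move=> i; rewrite inE; case: eqP => [->//|_ /=]; exact: tA.
  - by move=> i; rewrite !inE => /orP[/eqP ->|/ta ->]; rewrite ?jx ?eqxx ?orbT.
set B := \bigcap_(j in _) _ in mB open1 *.
pose C y := if y \in x :: a then set0 else
  B `&` (may_reach x y `&` chain n y (x :: a)).
have mC y : measurable (C y).
  rewrite /C; case: ifP => // _; do 2 (apply: measurableI => //).
    exact: measurable_may_reach.
  exact: measurable_chain.
have CP y : P (C y) <= if y \in x :: a then 0 else
    (m ^+ n)%:E * P B * reach_bound (delta x y).
  rewrite /C; case: ifPn => [_|yxa]; first by rewrite measure0.
  set r := delta x y.
  (* Splitting at the cutoff covers [may_reach] by events that each concern a single index, as
     [open1] requires. *)
  pose U0 := frogs M x @^-1` [set k | (K r <= k)%N].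
  pose U i := lifetime M x i @^-1` alive_at r.
  pose V U := U `&` B `&` chain n y (x :: a).
  have mV W : measurable W -> measurable (V W).
    by move=> mW; apply: measurableI; [exact: measurableI|exact: measurable_chain].
  have mU0 : measurable (V U0) by apply/mV/measurable_frogs.
  have mU i : measurable (V (U i)) by apply/mV/measurable_lifetime.
  have mUU : measurable (\big[setU/set0]_(i < K r) V (U i)).
    exact: bigsetU_measurable.
  apply: (@le_trans _ _ (P (V U0 `|` \big[setU/set0]_(i < K r) V (U i)))).
    apply: le_measure; rewrite ?inE //; first by have := mC y; rewrite /C (negbTE yxa).
      exact: measurableU.
    move=> w [Bw [[i [iw al]] cw]]; have [Kw|wK] := leqP (K r) (frogs M x w).
      by left.
    right; rewrite -(bigcup_mkord _ (fun i => V (U i))); exists i => //=.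
    exact: ltn_trans wK.
  apply: (le_trans (measureU2 _ _ _)) => //.
  apply: (@le_trans _ _ ((m ^+ n)%:E * P B * P U0 +
      \sum_(i < K r) (m ^+ n)%:E * P B * P (U i))).
    apply: leeD.
      apply: (open1 (inl (inl x))) => //.
      exact: (sigma_of_preimage (X := fun _ : unit => frogs M x : Omega -> nat) tt).
    apply: (le_trans (Boole_inequality P (A := fun i => V (U i)) (n := K r) _)) => //.
    apply: lee_sum => i _.
    apply: (open1 (inr (x, nat_of_ord i))) => //.
    exact: (sigma_of_preimage (X := fun _ : unit => lifetime M x i) tt).
  have Bfin : P B \is a fin_num by apply: fin_num_measure.
  rewrite -ge0_sume_distrr //.
  rewrite -ge0_muleDr; last 2 first.
  - exact: measure_ge0.
  - by apply: sume_ge0 => i _; exact: measure_ge0.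
  apply: lee_wpmul2l; first by rewrite mule_ge0 ?lee_fin ?exprn_ge0.
  rewrite /reach_bound; apply: leeD.
    by rewrite -(frogs_law M x).
  apply: (@le_trans _ _ (\sum_(i < K r) (p ^+ r)%:E)).
    by apply: lee_sum => i _; apply: geometric_lifetime_tail; exact: lifetime_law.
  by rewrite sumEFin sumr_const card_ord mulr_natl.
apply: (@le_measure_bigcup_countType _ _ _ P _ C) => //.
- by apply: measurableI => //; exact: measurable_chain.
- move=> w [Bw [y _]]; rewrite /=; case: ifP => // e H.
  by exists y => //; rewrite /C e.
- move=> s us; apply: (@le_trans _ _ (\sum_(y <- s) if y \in x :: a then 0 else
    (m ^+ n)%:E * P B * reach_bound (delta x y))).
    by apply: lee_sum.
  (* Dropping the forbidden sites, [x] among them, leaves a list to which [reach_bound_sum]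
     applies. *)
  rewrite (_ : \sum_(y <- s) _ = \sum_(y <- [seq y <- s | y \notin x :: a])
      (m ^+ n)%:E * P B * reach_bound (delta x y)); last first.
    by rewrite big_filter [RHS]big_mkcond; apply: eq_bigr => y _; case: ifP.
  rewrite -ge0_sume_distrr; last by move=> *; exact: reach_bound_ge0.
  rewrite exprSr EFinM -muleA -muleA [X in _ <= _ * X]muleC.
  apply: lee_wpmul2l; first by rewrite lee_fin exprn_ge0.
  apply: lee_wpmul2l => //.
  apply: reach_bound_sum; first exact: filter_uniq.
  by rewrite mem_filter inE eqxx.
Qed.

End ExitChains.

(** * From geometric bounds to almost sure extinction *)

Lemma measure0_of_geometric_bound (R : realType) (dO : measure_display)
    (Omega : measurableType dO) (P : probability Omega R) (q : R)
    (A : set Omega) :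
  0 <= q < 1 -> (forall n, P A <= (q ^+ n)%:E)%E -> measurable A -> P A = 0%E.
Proof.
move=> /andP[q0 q1] Aq mA.
have Pf : (P A \is a fin_num)%E by apply: fin_num_measure.
have q_cvg : (fun n => q ^+ n) @ \oo --> (0 : R).
  by apply: cvg_expr; rewrite ger0_norm.
suff : fine (P A) <= 0 by rewrite -lee_fin fineK // measure_le0 => /eqP.
rewrite -(cvg_lim _ q_cvg) //; apply: limr_ge; first by apply/cvg_ex; exists 0.
by apply: nearW => n; rewrite -lee_fin fineK.
Qed.

Section Extinction.
Local Open Scope ereal_scope.
Context {R : realType} {G : rooted_graph} {mu : probability nat R} {p : R}.
Context {dO : measure_display} {Omega : measurableType dO}.
Context {P : probability Omega R}.
Variable M : frog_model G mu p P.

Lemma measurable_hitting_time x y :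
  measurable_fun setT (fun w => hitting_time M w x y).
Proof.
apply: (@measurable_ereal_inf_countType _ _ _ nat
  (fun n w => exists i, [/\ (i < frogs M x w)%N, alive_at n (lifetime M x i w)
      & walk M x i n w = y]) (fun n _ => n%:R%:E)) => //.
move=> n; rewrite (_ : (fun w => _) = \bigcup_i
   ((frogs M x @^-1` [set k | (i < k)%N]) `&`
    ((lifetime M x i @^-1` alive_at n) `&` (walk M x i n @^-1` [set y])))).
  apply: bigcup_measurable => i _; apply: measurableI.
    exact: measurable_frogs.
  by apply: measurableI; [exact: measurable_lifetime|exact: measurable_walk].
by apply/seteqP; split => w [i]; [move=> [? ? ?]; exists i|move=> _ [? [? ?]]; exists i].
Qed.

Lemma measurable_activation_time x :
  measurable_fun setT (fun w => activation_time M w x).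
Proof.
apply: (@measurable_ereal_inf_countType _ _ _ (seq G)
  (fun s _ => path [rel y z | y != z] (Defs.root G) s /\ last (Defs.root G) s = x)
  (fun s w => \sum_(t <- pairmap (hitting_time M w) (Defs.root G) s) t)).
  (* The condition on [s] does not depend on [w], so the event is everything or empty. *)
  move=> s; set Q : Prop := _ /\ _; have [HQ|HQ] := pselect Q.
    by rewrite (_ : (fun _ => Q) = setT) //; apply/seteqP; split.
  by rewrite (_ : (fun _ => Q) = set0) //; apply/seteqP; split.
move=> s; elim: s (Defs.root G) => [|z s IH] y /=.
  by under eq_fun do rewrite big_nil; exact: measurable_cst.
under eq_fun do rewrite big_cons.
by apply: emeasurable_funD => //; exact: measurable_hitting_time.
Qed.

Lemma measurable_survives : measurable (survives M).
Proof.
rewrite (_ : survives M = \bigcap_m \bigcup_(x : G) \bigcup_i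
   ((frogs M x @^-1` [set k | (i < k)%N]) `&`
   \bigcup_n ((lifetime M x i @^-1` alive_at n) `&`
     (fun w => activation_time M w x + n%:R%:E) @^-1` [set m%:R%:E]))).
  apply: bigcap_measurableType => m _.
  apply: (@bigcup_countType_measurable _ _ G) => x.
  apply: bigcup_measurable => i _; apply: measurableI.
    exact: measurable_frogs.
  apply: bigcup_measurable => n _; apply: measurableI.
    exact: measurable_lifetime.
  rewrite -[X in measurable X]setTI.
  apply: emeasurable_funD => //; exact: measurable_activation_time.
apply/seteqP; split => w /= H m.
  by move=> _; have [x [i [? [n ? ?]]]] := H m; exists x => //; exists i => //;
    split=> //; exists n.
by have [x _ [i _ [? [n _ [? ?]]]]] := H m I; exists x, i; split=> //; exists n.
Qed.

Definition hits w (x y : G) : Prop := exists i n,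
  [/\ (i < frogs M x w)%N, alive_at n (lifetime M x i w) & walk M x i n w = y].

Lemma hits_hitting_time w x y : hitting_time M w x y < +oo -> hits w x y.
Proof.
apply: contraPP => nh; apply/negP; rewrite -leNgt.
apply/ereal_infP => _ [n [i H] <-]; exfalso; apply: nh; by exists i, n.
Qed.

Lemma hitting_time_ge0 w x y : 0 <= hitting_time M w x y.
Proof. by apply/ereal_infP => _ [n _ <-]; rewrite lee_fin. Qed.

(** If the infimum is finite, some sequence has a finite sum; since its terms are nonnegative, each
    of them is finite, and a finite hitting time comes from an actual hit. *)
Lemma activation_time_path w x : activation_time M w x < +oo ->
  exists2 s, path (fun y z => `[< hits w y z >]) (Defs.root G) s &
    last (Defs.root G) s = x.
Proof.
apply: contraPP => nh; apply/negP; rewrite -leNgt.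
apply/ereal_infP => _ [s [_ sx] <-]; rewrite leNgt; apply/negP => sfin.
apply: nh; exists s => //; move: sfin; clear sx x.
elim: s (Defs.root G) => [//|z s IH] y /=; rewrite big_cons => yzs.
have s0 : 0 <= \sum_(t <- pairmap (hitting_time M w) z s) t.
  elim: s z {IH yzs} => [|u s IH] z /=; first by rewrite big_nil.
  by rewrite big_cons adde_ge0 // hitting_time_ge0.
apply/andP; split.
  apply/asboolP/hits_hitting_time; apply: le_lt_trans yzs.
  exact: leeDl.
by apply: IH; apply: le_lt_trans yzs; apply: leeDr; exact: hitting_time_ge0.
Qed.

Variable delta : G -> G -> nat.

(** Deterministic part: without chains of length [N], only finitely many sites are activated, each
    holding finitely many particles with finite lifetimes, so only finitely many times see an active
    particle. *)
Lemma dies_out w N :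
  (forall x i n, (delta x (walk M x i n w) <= n)%N) ->
  (forall x i, lifetime M x i w <> None) ->
  ~ chain M delta N (Defs.root G) [::] w -> ~ survives M w.
Proof.
move=> speed mortal nochain surv.
(* The default 0 is never taken, since [mortal] excludes [None]. *)
pose L x i := odflt 0%N (lifetime M x i w).
have LP x i n : alive_at n (lifetime M x i w) -> (n < L x i)%N.
  by rewrite /L; have := mortal x i; case: (lifetime M x i w).
pose e y z := `[< hits w y z >].
have e_reach y z : e y z -> may_reach M delta y z w.
  move=> /asboolP[i [n [iw al yz]]]; exists i; split=> //.
  have := speed y i n; rewrite yz; move: al.
  by case: (lifetime M y i w) => //= k; move=> nk dn; exact: leq_ltn_trans nk.
pose V n := [set x | exists s, [/\ size s = n, path e (Defs.root G) s & last (Defs.root G) s = x]].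
(* By induction on [n]: a site of [V n] has finitely many particles, each visiting finitely many
   sites before it dies. *)
have finV n : finite_set (V n).
  elim: n => [|n IH].
    apply: (@sub_finite_set _ _ [set Defs.root G]); last exact: finite_set1.
    by move=> x [[|y s] []] //= _ _ <-.
  apply: (@sub_finite_set _ _ (\bigcup_(y in V n) \bigcup_(i in `I_(frogs M y w))
      [set walk M y i k w | k in `I_(L y i)])).
    move=> x [s]; case/lastP: s => [[] //|s z].
    rewrite size_rcons rcons_path last_rcons => -[[sn] /andP[es ez] <-].
    exists (last (Defs.root G) s); first by exists s.
    move: ez => /asboolP[i [k [iw al <-]]].
    by exists i => //; exists k => //; apply: LP.
  apply: bigcup_finite => // y _; apply: bigcup_finite; first exact: finite_II.
  by move=> i _; apply: finite_image; exact: finite_II.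
have Vact x : activation_time M w x < +oo -> exists2 n, (n < N)%N & V n x.
  move=> /activation_time_path[s es <-].
  (* Loops are erased to obtain a self-avoiding path; if it had [N] steps or more, its first [N]
     steps would form a forbidden chain. *)
  have [s' es' us' _] := shortenP es.
  exists (size s'); last by exists s'.
  rewrite ltnNge; apply/negP => Ns; apply: nochain.
  have <- : size (take N s') = N by rewrite size_takel.
  apply: path_chain => //; last exact/allP.
    have esN : path e (Defs.root G) (take N s') by exact: take_path.
    by apply: sub_path esN => y z yz; exact/asboolP/e_reach.
  by have := take_uniq N.+1 us'.
(* Survival puts every natural number among the finitely many values of an activation time plus an
   age. *)
apply: infinite_nat.
apply: (@sub_finite_set _ _ ((fun m : nat => m%:R%:E : \bar R) @^-1`
    \bigcup_(n in `I_N) \bigcup_(x in V n) \bigcup_(i in `I_(frogs M x w))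
      [set activation_time M w x + k%:R%:E | k in `I_(L x i)])).
  move=> m _; have [x [i [iw [k al Tm]]]] := surv m.
  have [|n nN Vx] := Vact x.
    by rewrite ltey; apply/eqP => Tx; move: Tm; rewrite Tx.
  by exists n => //; exists x => //; exists i => //; exists k => //; apply: LP.
apply: finite_preimage.
  by move=> a b _ _ [] /eqP; rewrite eqr_nat => /eqP.
apply: bigcup_finite; first exact: finite_II.
move=> n _; apply: bigcup_finite => // x _.
apply: bigcup_finite; first exact: finite_II.
by move=> i _; apply: finite_image; exact: finite_II.
Qed.

Hypothesis delta_refl : forall x, delta x x = 0%N.
Hypothesis delta_step :
  forall x y z, adj y z -> (delta x z <= (delta x y).+1)%N.
Variables (K : nat -> nat) (m : R).
Hypothesis p01 : (0 <= p < 1)%R.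
Hypothesis m01 : (0 <= m < 1)%R.
Hypothesis reach_bound_sum : forall x (s : seq G), uniq s -> x \notin s ->
  \sum_(y <- s) reach_bound (mu := mu) (p := p) K (delta x y) <= m%:E.

(** Outside three null events (a walk that is too fast, an immortal particle, chains of every length
    from the root), [dies_out] applies. *)
Lemma survives_null : P (survives M) = 0.
Proof.
have [p0 p1] := andP p01; have [m0 m1] := andP m01.
suff : P.-negligible (survives M) by move/negligibleP; apply; exact: measurable_survives.
apply: (@negligibleS _ _ _ P (
   (\bigcup_(x : G) \bigcup_i [set w | exists n, (n < delta x (walk M x i n w))%N]) `|`
   (\bigcup_(x : G) \bigcup_i [set w | lifetime M x i w = None]) `|`
   \bigcap_n chain M delta n (Defs.root G) [::])).
  move=> w sw; apply: contrapT => /not_orP[/not_orP[sp mo] ch].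
  have [N nch] : exists N, ~ chain M delta N (Defs.root G) [::] w.
    by apply: contrapT => /forallNP H; apply: ch => n _; apply: contrapT; exact: H.
  apply: (dies_out _ _ nch sw).
    move=> x i n; rewrite leqNgt; apply/negP => H.
    by apply: sp; exists x => //; exists i => //; exists n.
  by move=> x i H; apply: mo; exists x => //; exists i.
apply: negligibleU; first apply: negligibleU.
- apply: (@negligible_bigcup_countType _ _ _ P G) => x; apply: negligible_bigcup => i.
  exact: (simple_random_walk_speed delta_refl delta_step (walk_law M x i)).
- apply: (@negligible_bigcup_countType _ _ _ P G) => x; apply: negligible_bigcup => i.
  (* An immortal particle is alive at every age [n], an event of probability at most [p ^+ n]. *)
  apply/negligibleP; first exact: (measurable_lifetime M x i [set None]).
  apply: (measure0_of_geometric_bound p01) => [n|]; last exact: (measurable_lifetime M x i [set None]).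
  apply: le_trans (geometric_lifetime_tail n (lifetime_law M x i)).
  apply: le_measure; rewrite ?inE //.
  - exact: (measurable_lifetime M x i [set None]).
  - exact: (measurable_lifetime M x i (alive_at n)).
  - by move=> w /= ->.
- have mch n : measurable (chain M delta n (Defs.root G) [::]) by exact: measurable_chain.
  have mC : measurable (\bigcap_n chain M delta n (Defs.root G) [::]).
    by apply: bigcap_measurableType => n _.
  apply/negligibleP => //; apply: (measure0_of_geometric_bound m01) => // n.
  apply: (@le_trans _ _ (P (chain M delta n (Defs.root G) [::]))).
    by apply: le_measure; rewrite ?inE // => w; apply.
  (* At the root no particle has been opened yet: both lists are empty and the intersection is
     [setT]. *)
  have := @chain_bound _ _ _ _ _ _ _ M delta K p0 m m0 reach_bound_sum n
    (Defs.root G) [::] [::] (fun=> setT) isT isT.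
  rewrite (_ : \bigcap_(j in [set` [::]]) _ = setT); last by apply/seteqP; split.
  by rewrite setTI probability_setT mule1; apply.
Qed.

End Extinction.

(** * Counting lattice points in sup-norm boxes *)

Lemma leq_wexp2r (a b e : nat) : (a <= b -> a ^ e <= b ^ e)%N.
Proof. by case: e => // e ab; rewrite leq_exp2r. Qed.

Section LatticeBoxes.
Variable d : nat.
Implicit Types (v : 'rV[int]_d) (s : seq 'rV[int]_d).

Definition sup_norm v : nat := \max_(i < d) `|v ord0 i|%N.

Lemma sup_norm0 : sup_norm 0 = 0%N.
Proof. by rewrite /sup_norm big1 // => i _; rewrite mxE. Qed.

Lemma le_sup_norm v i : (`|v ord0 i| <= sup_norm v)%N.
Proof. exact: (leq_bigmax (F := fun i => `|v ord0 i|%N) i). Qed.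

Lemma sup_norm_eq0 v : sup_norm v = 0%N -> v = 0.
Proof.
move=> v0; apply/rowP => i; have := le_sup_norm v i.
by rewrite v0 leqn0 absz_eq0 mxE => /eqP.
Qed.

Lemma sup_norm_adj (x y z : 'rV[int]_d) :
  lattice_adj y z -> (sup_norm (z - x) <= (sup_norm (y - x)).+1)%N.
Proof.
move=> /eqP yz; apply/bigmax_leqP => i _.
have near : `|y ord0 i - z ord0 i| <= 1.
  by rewrite -yz (bigD1 i) //= lerDl sumr_ge0.
have := le_sup_norm (y - x) i; rewrite !mxE; move: near.
by move: (x ord0 i) (y ord0 i) (z ord0 i) => a b c; rewrite ler_norml => /andP[]; lia.
Qed.

Lemma size_box s r : uniq s ->
  (size [seq v <- s | (sup_norm v <= r)%N] <= r.*2.+1 ^ d)%N.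
Proof.
move=> us.
pose f (g : {ffun 'I_d -> 'I_(r.*2.+1)}) : 'rV[int]_d :=
  \row_i ((g i : nat)%:Z - r%:Z).
have -> : (r.*2.+1 ^ d = size (map f (enum {ffun 'I_d -> 'I_(r.*2.+1)})))%N.
  by rewrite size_map -cardE card_ffun !card_ord.
apply: uniq_leq_size; first exact: filter_uniq.
move=> v; rewrite mem_filter => /andP[vr _]; apply/mapP.
have vi i : (`|v ord0 i| <= r)%N by exact: leq_trans (le_sup_norm v i) vr.
exists [ffun i => inord (absz (v ord0 i + r%:Z))]; first by rewrite mem_enum.
apply/rowP => i; rewrite mxE ffunE; have := vi i.
move: (v ord0 i : int) => a ar; rewrite inordK; last by rewrite -addnn; lia.
by rewrite gez0_abs; lia.
Qed.

(** At most [(2 * r + 1) ^ d <= (3 ^ r) ^ d] points have norm [r >= 1], so with [u = 3 ^+ d * q] the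
    sum is at most [u / (1 - u)], which is at most 1/4 for [u <= 1/5]. *)
Lemma sum_exp_sup_norm (R : realFieldType) s (q : R) : uniq s -> 0 \notin s ->
  0 <= q -> 3 ^+ d * q <= 5^-1 -> \sum_(v <- s) q ^+ sup_norm v <= 4^-1.
Proof.
move=> us s0 q0 qd; set u := 3 ^+ d * q in qd.
have u0 : 0 <= u by rewrite mulr_ge0 ?exprn_ge0.
pose N := (\max_(v <- s) sup_norm v)%N.
(* Points are sorted by norm; nonzero points have positive norm, hence the shift to [r.+1]. *)
have -> : \sum_(v <- s) q ^+ sup_norm v =
    \sum_(v <- s) \sum_(r < N) (if sup_norm v == r.+1 then q ^+ r.+1 else 0).
  apply: eq_big_seq => v vs.
  have v0 : (0 < sup_norm v)%N.
    by rewrite lt0n; apply: contraNneq s0 => /sup_norm_eq0 <-.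
  have vN : ((sup_norm v).-1 < N)%N by rewrite prednK // /N (leq_bigmax_seq v).
  rewrite -big_mkcond (big_pred1 (Ordinal vN)) /= ?prednK // => r.
  apply/eqP/eqP => [e|->]; last by rewrite /= prednK.
  by apply: val_inj; rewrite /= e.
rewrite exchange_big /=.
apply: (@le_trans _ _ (\sum_(r < N) u * u ^+ r)).
  apply: ler_sum => r _; rewrite -exprS exprMn -big_mkcond /= -big_filter.
  rewrite big_const_seq count_predT iter_addr_0 -[leLHS]mulr_natl.
  apply: ler_wpM2r; first exact: exprn_ge0.
  apply: (@le_trans _ _ ((r.+1).*2.+1 ^ d)%:R).
    rewrite ler_nat; apply: leq_trans (size_box r.+1 us).
    rewrite !size_filter; apply: sub_count => v /= /eqP ->.
    exact: leqnn.
  rewrite -exprM mulnC exprM -!natrX ler_nat; apply: leq_wexp2r.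
  by elim: (nat_of_ord r) => // k IH; rewrite expnS; lia.
rewrite -mulr_sumr.
have u1 : 0 < 1 - u by lra.
rewrite -(ler_pM2l u1) mulrCA.
have -> : (1 - u) * (\sum_(r < N) u ^+ r) = 1 - u ^+ N.
  by have := subrX1 u N; lra.
have uN : 0 <= u ^+ N by exact: exprn_ge0.
nra.
Qed.

(** The points counted lie in the box of radius [L = trunc_log b k]. Excluding 0 makes the count
    vanish when [L = 0]; otherwise [2 * L + 1 <= 3 * L]. Thus no additive constant appears, and the
    expected count can be made small by taking [b] large. *)
Lemma sum_le_exp_sup_norm s (b k : nat) : uniq s -> 0 \notin s -> (1 < b)%N ->
  (\sum_(v <- s) (b ^ sup_norm v <= k) <= (3 * trunc_log b k) ^ d)%N.
Proof.
move=> us s0 b1; set L := trunc_log b k.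
have bL v : (b ^ sup_norm v <= k)%N -> (sup_norm v <= L)%N by exact: trunc_log_max.
have [L0|L0] := posnP L.
  rewrite big_seq big1 // => v vs.
  case: (leqP (b ^ sup_norm v) k) => // /bL; rewrite L0 leqn0 => /eqP/sup_norm_eq0 v0.
  by rewrite v0 (negbTE s0) in vs.
apply: (@leq_trans (L.*2.+1 ^ d)); last first.
  by apply: leq_wexp2r; rewrite -addnn; lia.
apply: leq_trans (size_box L us).
rewrite size_filter -sum1_count [X in (_ <= X)%N]big_mkcond /=.
by apply: leq_sum => v _; case: (leqP (b ^ sup_norm v) k) => // /bL ->.
Qed.

End LatticeBoxes.

(** * The reach bound on the lattice in terms of the logarithmic moment *)

Lemma trunc_log_le_ln (R : realType) (b k : nat) : (1 < b)%N ->
  (trunc_log b k)%:R * ln (b%:R : R) <= ln (maxn k 1)%:R.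
Proof.
move=> b1; case: k => [|k]; first by rewrite trunc_log0 mul0r (_ : maxn 0 1 = 1%N) // ln1.
rewrite (maxn_idPl _) // mulr_natl -lnXn ?ltr0n; last by lia.
rewrite -natrX ler_ln ?posrE ?ltr0n ?expn_gt0 //; last by lia.
by rewrite ler_nat; exact: trunc_logP.
Qed.

Section LatticeReachBound.
Context {R : realType} {disp : measure_display} {Omega : measurableType disp}.
Variables (P : probability Omega R) (eta : {RV P >-> nat}) (d : nat).
Implicit Types s : seq 'rV[int]_d.

Local Notation log_moment :=
  ('E_P[(fun w => ln (maxn (eta w) 1)%:R ^+ d)%R])%E.

(** The sum of probabilities is the expected number of points [v] with [b ^ sup_norm v <= eta],
    which is bounded pointwise by the box count. *)
Lemma sum_tail_sup_norm s (b : nat) : uniq s -> 0 \notin s -> (1 < b)%N ->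
  (\sum_(v <- s) P [set w | (b ^ sup_norm v <= eta w)%N] <=
    (3 ^+ d / ln b%:R ^+ d)%:E * log_moment)%E.
Proof.
move=> us s0 b1.
have lnb : 0 < ln (b%:R : R) by rewrite ln_gt0 // ltr1n.
have meta (T : Type) (g : nat -> T) (B : set T) : measurable ((g \o eta) @^-1` B).
  by rewrite comp_preimage; exact: measurable_funPTI.
have mtail v : measurable [set w | (b ^ sup_norm v <= eta w)%N].
  exact: (meta _ (leq (b ^ sup_norm v)) [set true]).
have mlog : measurable_fun setT (fun w => ln (maxn (eta w) 1)%:R ^+ d : R).
  by move=> _ B mB; rewrite setTI; exact: (meta _ (fun k => ln (maxn k 1)%:R ^+ d) B).
have log_ge0 k : 0 <= ln (maxn k 1)%:R ^+ d :> R.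
  by rewrite exprn_ge0 // ln_ge0 // ler1n leq_maxr.
under eq_bigr do rewrite -[X in P X]setIT -integral_indic //.
rewrite expectation.unlock -(@ge0_integral_sum _ _ _ P setT measurableT _
  (fun v w => (\1_[set w | (b ^ sup_norm v <= eta w)%N] w)%:E)) //; last first.
- by move=> v; apply/measurable_EFinP; exact: measurable_indic.
rewrite -ge0_integralZl //; last 3 first.
- exact/measurable_EFinP.
- by move=> w _; rewrite lee_fin.
- by rewrite lee_fin divr_ge0 // ?exprn_ge0 // ltW.
apply: ge0_le_integral => //.
- by move=> w _; apply: sume_ge0.
- by apply: emeasurable_sum => v; apply/measurable_EFinP; exact: measurable_indic.
- by apply: emeasurable_funM => //; exact/measurable_EFinP.
move=> w _; rewrite sumEFin -EFinM lee_fin.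
apply: (@le_trans _ _ ((3 * trunc_log b (eta w)) ^ d)%:R).
  have := sum_le_exp_sup_norm (eta w) us s0 b1.
  rewrite -(ler_nat R); apply: le_trans.
  rewrite natr_sum; apply: ler_sum => v _; rewrite indicE.
  rewrite (_ : (w \in _) = (b ^ sup_norm v <= eta w)%N) //.
  by apply/idP/idP => [/set_mem|/mem_set].
rewrite natrX natrM exprMn mulrAC -mulrA; apply: ler_wpM2l; first exact: exprn_ge0.
rewrite -expr_div_n lerXn2r ?nnegrE ?divr_ge0 ?ln_ge0 ?ler1n ?leq_maxr ?(ltnW b1) //.
by rewrite ler_pdivlMr //; exact: trunc_log_le_ln.
Qed.

(** After translating [x] to the origin, the tails of [eta] and the geometric terms [(b p) ^ r]
    contribute at most 1/4 each. *)
Lemma reach_bound_lattice (b : nat) (p : R) (x : 'rV[int]_d)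
    (s : seq 'rV[int]_d) :
  uniq s -> x \notin s -> (1 < b)%N -> 0 <= p ->
  ((3 ^+ d / ln b%:R ^+ d)%:E * log_moment <= (4^-1)%:E)%E ->
  3 ^+ d * (b%:R * p) <= 5^-1 ->
  (\sum_(y <- s) reach_bound (mu := distribution P eta) (p := p) (expn b)
    (sup_norm (y - x)) <= (2^-1)%:E)%E.
Proof.
move=> us xs b1 p0 Hlog Hp.
rewrite -(big_map (fun y => y - x) xpredT (fun v => reach_bound (expn b) (sup_norm v))).
set s' := map _ _.
have us' : uniq s' by rewrite map_inj_uniq //; exact: addIr.
have s'0 : 0 \notin s'.
  by apply: contra xs => /mapP[y ys /esym/eqP]; rewrite subr_eq0 => /eqP <-.
rewrite big_split /=.
have -> : 2^-1 = 4^-1 + 4^-1 :> R by lra.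
rewrite EFinD; apply: leeD.
  exact: le_trans (sum_tail_sup_norm us' s'0 b1) Hlog.
under eq_bigr do rewrite natrX -exprMn.
rewrite sumEFin lee_fin; apply: sum_exp_sup_norm => //.
by rewrite mulr_ge0.
Qed.

End LatticeReachBound.

Theorem theorem1p3 (R : realType) (d : nat) (disp : measure_display)
    (Omega : measurableType disp) (P : probability Omega R)
    (eta : {RV P >-> nat}) :
  (2 <= d)%N ->
  (0 < P [set w | (1 <= eta w)%N])%E ->
  ('E_P[(fun w => ln (maxn (eta w) 1)%:R ^+ d)%R] < +oo)%E ->
  (0 < critical_parameter (lattice d) (distribution P eta))%E.
Proof.
move=> d2 _ Efin; have d0 : (0 < d)%N by lia.
set E := 'E_P[_]%E in Efin.
have E0 : (0 <= E)%E.
  rewrite /E expectation.unlock; apply: integral_ge0 => w _.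
  by rewrite lee_fin exprn_ge0 // ln_ge0 // ler1n leq_maxr.
have Ef : E \is a fin_num by rewrite ge0_fin_numE.
have e0 : 0 <= fine E by exact: fine_ge0.
(* Once [C <= ln b], the summand 1 gives [1 <= ln b], hence [ln b <= ln b ^+ d]; the other summand
   then bounds the moment term by 1/4. *)
pose C : R := 1 + 4 * 3 ^+ d * fine E.
have C1 : 1 <= C by rewrite lerDl !mulr_ge0 // exprn_ge0.
(* The first successor already exceeds [expR C]; the second makes [1 < b] hold by computation. *)
pose b := (Num.truncn (expR C)).+2.
have bC : C <= ln b%:R.
  rewrite -[leLHS]expRK ler_ln ?posrE ?expR_gt0 ?ltr0n //.
  apply: le_trans (ltW (truncnS_gt _)) _.
  by rewrite ler_nat.
have lnb1 : 1 <= ln b%:R :> R by exact: le_trans bC.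
have lnbd : C <= ln b%:R ^+ d by apply: le_trans bC _; rewrite ler_eXnr.
have Hlog : ((3 ^+ d / ln b%:R ^+ d)%:E * E <= (4^-1)%:E)%E.
  rewrite -(fineK Ef) -EFinM lee_fin mulrAC ler_pdivrMr; last first.
    by rewrite exprn_gt0 //; lra.
  have := le_trans (_ : 4 * 3 ^+ d * fine E <= C) lnbd.
  rewrite /C; lra.
(* Chosen so that [p < p0] gives [3 ^+ d * (b * p) < 1/5], the condition on the geometric sum. Every
   [p] with possible survival is shown to be at least [p0]. *)
pose p0 : R := (5 * (3 ^+ d * b%:R))^-1.
have p00 : 0 < p0 by rewrite invr_gt0 !mulr_gt0 // ?exprn_gt0 // ltr0n.
apply: (@lt_le_trans _ _ p0%:E); first by rewrite lte_fin.
apply/ereal_infP => _ [p [/andP[p_ge0 p_le1] [dS [OS [PS [M surv]]]]] <-].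
rewrite lee_fin leNgt; apply/negP => pp0.
suff : PS (survives M) = 0%E by move=> e; rewrite e ltxx in surv.
have t1 : 1 <= 3 ^+ d :> R by apply: exprn_ege1; rewrite ler1n.
have b1 : 1 <= b%:R :> R by rewrite ler1n.
have tb1 : 1 <= 3 ^+ d * b%:R :> R by nra.
have p1 : p < 1.
  by apply: lt_le_trans pp0 _; rewrite invf_le1; lra.
apply: (@survives_null R (lattice d) _ _ _ _ _ M (fun x y => sup_norm (y - x))
  _ _ (expn b) 2^-1).
- by move=> x; rewrite subrr sup_norm0.
- by move=> x y z; exact: sup_norm_adj.
- by rewrite p_ge0.
- lra.
move=> x s us xs; apply: reach_bound_lattice => //.
rewrite mulrA -ler_pdivlMl ?mulr_gt0 ?exprn_gt0 ?ltr0n //.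
by rewrite -invfM mulrC ltW // mulrC.
Qed.
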